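(* Let $q,r$ be positive integers, and let $\zeta(\alpha_1,\alpha_2,\ldots,\alpha_q+1)$ (with $\alpha_1,\dots,\alpha_q$ positive integers) be a multiple zeta value of depth $q$ and weight $\alpha_1+\cdots+\alpha_q+1=q+r$, with dual $\zeta(\beta_1,\beta_2,\ldots,\beta_r+1)$ of depth $r$. Put $\boldsymbol\alpha=(\alpha_1,\ldots,\alpha_q)$ and $\boldsymbol\beta=(\beta_1,\ldots,\beta_r)$. Then for every nonnegative integer $m$ and every real $x$ with $x+1>0$, $$\mathcal Z^{\boldsymbol\beta}_1(m+1;x)=\sum_{|\boldsymbol d|=m}M_q(\boldsymbol\alpha,\boldsymbol d)\,\zeta(\alpha_1+d_1,\ldots,\alpha_{q-1}+d_{q-1},\alpha_q+d_q+d_{q+1}+1;x),$$ where the sum is over all $(q+1)$-tuples $\boldsymbol d=(d_1,\ldots,d_{q+1})$ of nonnegative integers with $|\boldsymbol d|=d_1+\cdots+d_{q+1}=m$.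
   Context: For an $r$-tuple $\boldsymbol\beta$ of positive integers, real $x>-1$ and complex $s$ with $\Re(s)>1-r$, $$\mathcal Z^{\boldsymbol\beta}_1(s;x)=\frac{1}{\Gamma(s)}\int_0^\infty\frac{e^{-xt}}{e^t-1}\,Li_{\boldsymbol\beta}(1-e^{-t})\,t^{s-1}\,dt,\qquad Li_{\boldsymbol\beta}(z)=\sum_{1\le n_1<\cdots<n_r}\frac{z^{n_r}}{n_1^{\beta_1}\cdots n_r^{\beta_r}}.$$ $$M_q(\boldsymbol\alpha,\boldsymbol d)=\prod_{j=1}^q\binom{\alpha_j+d_j-1}{d_j}.$$ For positive integers $\alpha_1,\dots,\alpha_q$ and $x>-1$, $$\zeta(\alpha_1,\ldots,\alpha_{q-1},\alpha_q+1;x)=\sum_{1\le n_1<\cdots<n_q}(n_1+x)^{-\alpha_1}\cdots(n_{q-1}+x)^{-\alpha_{q-1}}(n_q+x)^{-\alpha_q-1},$$ and the multiple zeta value $\zeta(\alpha_1,\ldots,\alpha_q+1)$ is the case $x=0$. Duality: let $\{1\}^a$ denote $a$ repetitions of $1$. Every index can be written uniquely as $(\alpha_1,\ldots,\alpha_q+1)=(\{1\}^{a_1},b_1+2,\{1\}^{a_2},b_2+2,\ldots,\{1\}^{a_\ell},b_\ell+2)$ with nonnegative integers $a_i,b_i$; its dual index is $(\beta_1,\ldots,\beta_r+1)=(\{1\}^{b_\ell},a_\ell+2,\{1\}^{b_{\ell-1}},a_{\ell-1}+2,\ldots,\{1\}^{b_1},a_1+2)$, and $\zeta(\beta_1,\ldots,\beta_r+1)$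 is called the dual of $\zeta(\alpha_1,\ldots,\alpha_q+1)$. *)

(* Defs.v *)
From HB Require Import structures.
From mathcomp Require Import all_boot all_order all_algebra.
From mathcomp Require Import all_classical all_reals all_analysis.

Set Implicit Arguments.
Unset Strict Implicit.
Unset Printing Implicit Defensive.

Import Order.TTheory GRing.Theory Num.Theory.
Import numFieldNormedType.Exports.

Local Open Scope classical_set_scope.
Local Open Scope ring_scope.

(* 0 < n_1 < ... < n_r; the type of [n] adds the truncation n_r <= N. *)
Definition increasing (r N : nat) (n : r.-tuple 'I_N.+1) : bool :=
  path ltn 0%N [seq val i | i <- n].

(* Infinite sums over 1 <= n_1 < ... < n_r are limits, as N tends to infinity,
   of the finite sums over 1 <= n_1 < ... < n_r <= N.  The index [k] contains
   the last entry in full: zeta(alpha_1, ..., alpha_q + 1; x) is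
   [mzeta k x] with k = (alpha_1, ..., alpha_q + 1). *)
Definition mzeta (R : realType) (q : nat) (k : q.-tuple nat) (x : R) : R :=
  limn (fun N : nat => \sum_(n : q.-tuple 'I_N.+1 | increasing n)
    \prod_(j < q) ((tnth n j)%:R + x) ^- tnth k j).

(* [last 0 n] is n_r. *)
Definition Li (R : realType) (r : nat) (beta : r.-tuple nat) (z : R) : R :=
  limn (fun N : nat => \sum_(n : r.-tuple 'I_N.+1 | increasing n)
    z ^+ last 0%N [seq val i | i <- n]
      / \prod_(j < r) (tnth n j)%:R ^+ tnth beta j).

(* Euler's integral, hence the Gamma function for 0 < s only. *)
Definition Gamma (R : realType) (s : R) : R :=
  \int[lebesgue_measure]_(t in `]0, +oo[) (t `^ (s - 1) * expR (- t)).

(* The function Z_1^beta(s; x) on the positive real axis 0 < s. *)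
Definition Z1 (R : realType) (r : nat) (beta : r.-tuple nat) (s x : R) : R :=
  (Gamma s)^-1 *
  \int[lebesgue_measure]_(t in `]0, +oo[)
    (expR (- (x * t)) / (expR t - 1) * Li beta (1 - expR (- t))
       * t `^ (s - 1)).

(* For a (q+1)-tuple d, [initial d] gives the entries d_1, ..., d_q. *)
Definition initial (q m : nat) (d : q.+1.-tuple 'I_m.+1) (j : 'I_q) : nat :=
  tnth d (widen_ord (leqnSn q) j).

Definition Mcoef (q m : nat) (alpha : q.-tuple nat)
    (d : q.+1.-tuple 'I_m.+1) : nat :=
  (\prod_(j < q) 'C(tnth alpha j + initial d j - 1, initial d j))%N.

(* (alpha_1 + d_1, ..., alpha_(q-1) + d_(q-1), alpha_q + d_q + d_(q+1) + 1) *)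
Definition shifted_index (q m : nat) (alpha : q.-tuple nat)
    (d : q.+1.-tuple 'I_m.+1) : q.-tuple nat :=
  [tuple (tnth alpha j + initial d j
          + (if j.+1 == q then tnth d ord_max + 1 else 0))%N | j < q].

(* (k_1, ..., k_q) |-> (k_1, ..., k_(q-1), k_q + 1), for 0 < q *)
Definition incr_last (k : seq nat) : seq nat := incr_nth k (size k).-1.

(* [:: (a_1, b_1); ...; (a_l, b_l)] encodes the index
   ({1}^a_1, b_1 + 2, ..., {1}^a_l, b_l + 2). *)
Definition index_of_blocks (c : seq (nat * nat)) : seq nat :=
  flatten [seq rcons (nseq ab.1 1%N) ab.2.+2 | ab <- c].

Definition dual_index (k k' : seq nat) : Prop :=
  exists2 c : seq (nat * nat), k = index_of_blocks c
    & k' = index_of_blocks (rev [seq (ab.2, ab.1) | ab <- c]).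

(* Main.v *)
Require Import Defs.
From HB Require Import structures.
From mathcomp Require Import all_boot all_order all_algebra.
From mathcomp Require Import all_classical all_reals all_analysis.
From mathcomp Require Import measurable_realfun ring zify.

(** The proof moves letters one at a time from one side of a connected double
    sum to the other.

    Write an index as a word: an entry a is the letter true followed by a - 1
    letters false.  Reading the word from the left, true means: sum over all
    smaller integers, then multiply by h n; false means: multiply by h n.  For
    h n = 1/n this builds the coefficients a(n) of Li_beta, for
    h n = 1/(n + x) the truncated multiple zeta values
    ([nested_sum], [sum_increasing]).  Duality of indices is reversal of words
    combined with the exchange of the letters ([word_dual]).

    Expanding Li_beta under the integral sign, with
    1/(e^t - 1) = e^(-t)/(1 - e^(-t)), gives
      Z_1^beta(m + 1; x) = sum_(n >= 1) a(n) K_m(x + 1, n - 1),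
      K_j(c, n) = int_0^oo e^(-c t) (1 - e^(-t))^n t^j/j! dt.
    The generating function K(c, n) = sum_j K_j(c, n) y^j satisfies
      (1) K(c, n + 1) = K(c, n) - K(c + 1, n), since e^(-t) = 1 - (1 - e^(-t));
      (2) (c - y) K(c, n) = n K(c + 1, n - 1) for n > 0, and
          (c - y) K(c, 0) = 1;
    and geometric series under the integral sign turn (1) into
      (3) sum_(i >= 0) K(c + 1, n + i) = K(c, n),
          sum_(i >= 0) K(c + i, n + 1) = K(c, n).
    Consider sums over k >= 1 and n >= 0 of [y^m] a(n) b_k(y) K(x + k, n).  By
    (2), one factor 1/n of a(n) becomes a factor 1/(x + k - y) of b_k while
    K(x + k, n) becomes K(x + k + 1, n - 1); then (3) either cancels a summation
    in a or creates one in b.  So each letter removed at the end of the word of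
    beta adds the opposite letter to a word that builds b
    ([connected_sum_false], [connected_sum_true], [connected_sum_transport]).
    When beta is used up, b_k times K(x + k, 0) is the nested sum of the index
    (alpha_1, ..., alpha_q + 1) with h n = 1/(n + x - y) ([nested_duality]).
    In other words Z_1^beta(1; x - y) = zeta(alpha_1, ..., alpha_q + 1; x - y)
    as power series in y.  The coefficient of y^m on the right is the sum in the
    theorem, because
      (c - y)^(-a) = sum_d 'C(a + d - 1, d) c^(-a - d) y^d
    and the extra factor 1/(n_q + x - y) contributes d_(q+1)
    ([coef_weight_prod]).

    All terms are nonnegative, so that sums and integrals are exchanged in the
    extended reals; the series that define mzeta and Li are shown to converge
    separately ([is_cvg_mzeta], [nneseries_Li]). *)

Set Implicit Arguments.
Unset Strict Implicit.
Unset Printing Implicit Defensive.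

Import Order.TTheory GRing.Theory Num.Theory.
Import numFieldNormedType.Exports.

Local Open Scope classical_set_scope.
Local Open Scope ring_scope.

(** * Indices as words, and nested sums *)
Definition word (k : seq nat) : seq bool :=
  flatten [seq true :: nseq a.-1 false | a <- k].

Definition nested_step (S : comNzRingType) (h f : nat -> S) (l : bool)
    (n : nat) : S :=
  h n * (if l then \sum_(i < n) f i else f n).

(** The initial function is the indicator of 0: it stands for n_0 = 0, so that
    the first letter true yields a sum over n_1 >= 1. *)
Definition nested_sum (S : comNzRingType) (h : nat -> S) (w : seq bool) :
    nat -> S :=
  foldl (nested_step h) (fun n => (n == 0%N)%:R) w.

Lemma rcons_nseq (T : Type) n (x : T) : rcons (nseq n x) x = nseq n.+1 x.
Proof. by elim: n => //= n ->. Qed.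

Lemma word_rcons k a : word (rcons k a) = word k ++ true :: nseq a.-1 false.
Proof. by rewrite /word map_rcons flatten_rcons. Qed.

Lemma nested_rcons (S : comNzRingType) (h : nat -> S) w l :
  nested_sum h (rcons w l) = nested_step h (nested_sum h w) l.
Proof. by rewrite /nested_sum foldl_rcons. Qed.

(** No increasing sequence of positive integers ends at 0. *)
Lemma nested_true0 (S : comNzRingType) (h : nat -> S) w :
  nested_sum h (true :: w) 0 = 0.
Proof.
elim/last_ind: w => [|w l IH].
  by rewrite /nested_sum /= /nested_step big_ord0 mulr0.
rewrite -rcons_cons nested_rcons /nested_step; case: l.
  by rewrite big_ord0 mulr0.
by rewrite IH mulr0.
Qed.

Lemma nested_word_rcons (S : comNzRingType) (h : nat -> S) k a n : (0 < a)%N ->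
  nested_sum h (word (rcons k a)) n =
  h n ^+ a * \sum_(i < n) nested_sum h (word k) i.
Proof.
case: a => // a _; rewrite word_rcons /=.
elim: a => [|a IH] in n *.
  by rewrite /= cats1 nested_rcons /nested_step expr1.
rewrite -rcons_nseq -(rcons_cat false _ (true :: _)) nested_rcons.
by rewrite /nested_step IH mulrA -exprS.
Qed.

Lemma incr_last_rcons k a : incr_last (rcons k a) = rcons k a.+1.
Proof. by rewrite /incr_last size_rcons /=; elim: k => //= b k ->. Qed.

Lemma word_incr_last k : k != [::] -> all (leq 1) k ->
  word (incr_last k) = rcons (word k) false.
Proof.
case/lastP: k => // k a _; rewrite all_rcons => /andP[a0 _].
rewrite incr_last_rcons !word_rcons rcons_cat rcons_cons rcons_nseq.
by case: a a0.
Qed.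

(** In a block ({1}^a, b + 2) the letters true gather in front; this is the
    form in which duality becomes visible. *)
Lemma word_blocks c : word (index_of_blocks c) =
  flatten [seq nseq ab.1.+1 true ++ nseq ab.2.+1 false | ab <- c].
Proof.
have wcat k1 k2 : word (k1 ++ k2) = word k1 ++ word k2.
  by rewrite /word map_cat flatten_cat.
elim: c => //= -[a b] c IH; rewrite /index_of_blocks /= wcat.
rewrite -/(index_of_blocks c) IH word_rcons /=.
rewrite -!cat_cons; congr (_ ++ _); rewrite -cat_rcons.
have -> : word (nseq a 1%N) = nseq a true by elim: a {IH} => //= a <-.
by rewrite rcons_nseq.
Qed.

(** Reversing the list of blocks reverses the word; swapping a and b within a
    block exchanges the two letters. *)
Lemma word_dual k k' : dual_index k k' -> rev (map negb (word k')) = word k.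
Proof.
case=> c -> ->; rewrite !word_blocks map_rev.
elim: c => //= -[a b] c IH.
rewrite rev_cons -cats1 flatten_cat map_cat rev_cat IH /= cats0.
rewrite map_cat -[_ :: (_ ++ _)]/((false :: _) ++ _) rev_cat.
rewrite -[true :: (_ ++ _) ++ _]/((nseq a.+1 true ++ nseq b.+1 false) ++ _).
rewrite -[false :: nseq a _]/(nseq a.+1 _) !map_nseq.
by rewrite -[false :: nseq b _]/(nseq b.+1 _) !rev_nseq.
Qed.

Lemma sum_tuple_rcons (S : comNzRingType) (T : finType) (q : nat)
    (Q : pred (q.+1.-tuple T)) (F : q.+1.-tuple T -> S) :
  \sum_(d | Q d) F d =
  \sum_(d : q.-tuple T) \sum_(e : T | Q [tuple of rcons d e])
     F [tuple of rcons d e].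
Proof.
rewrite pair_big_dep /=.
pose g (d : q.+1.-tuple T) : q.-tuple T * T :=
  ([tuple tnth d (widen_ord (leqnSn q) i) | i < q], tnth d ord_max).
pose f (p : q.-tuple T * T) := [tuple of rcons p.1 p.2].
have fg : cancel f g.
  case=> d e; rewrite /f /g /=; congr pair.
    apply: eq_from_tnth => i; rewrite tnth_mktuple !(tnth_nth e) /=.
    by rewrite nth_rcons size_tuple ltn_ord.
  by rewrite (tnth_nth e) /= nth_rcons size_tuple ltnn eqxx.
have gf : cancel g f.
  move=> d; apply: eq_from_tnth => i.
  rewrite (tnth_nth (tnth d i)) /= nth_rcons size_map size_enum_ord.
  case: ltnP => iq.
    rewrite (nth_map (Ordinal iq)) ?size_enum_ord//.
    by congr (tnth d); apply: val_inj; rewrite /= nth_enum_ord.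
  have -> : i = ord_max.
    by apply: val_inj => /=; apply/eqP; rewrite eqn_leq iq -ltnS ltn_ord.
  by rewrite eqxx.
rewrite (reindex f) /=; last by exists g => ? _; [apply: fg|apply: gf].
by [].
Qed.

Lemma tnth_rcons_widen (T : Type) q (d : q.-tuple T) (e : T) (j : 'I_q) :
  tnth [tuple of rcons d e] (widen_ord (leqnSn q) j) = tnth d j.
Proof. by rewrite !(tnth_nth e) /= nth_rcons size_tuple ltn_ord. Qed.

Lemma tnth_rcons_max (T : Type) q (d : q.-tuple T) (e : T) :
  tnth [tuple of rcons d e] ord_max = e.
Proof. by rewrite (tnth_nth e) /= nth_rcons size_tuple ltnn eqxx. Qed.

(** The largest entry n_q is summed last.  For fixed n_q the remaining sum runs
    over the increasing (q-1)-tuples below it, which is the recursion that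
    defines nested sums. *)
Lemma sum_increasing (S : comNzRingType) (h g : nat -> S) q
    (k : q.-tuple nat) N :
  (forall j, 0 < tnth k j)%N ->
  \sum_(n : q.-tuple 'I_N.+1 | increasing n)
     (\prod_(j < q) h (tnth n j) ^+ tnth k j) *
     g (last 0%N [seq val i | i <- n]) =
  \sum_(n < N.+1) nested_sum h (word k) n * g n.
Proof.
elim: q g k => [|q IH] g k k_gt0.
  rewrite (big_pred1 [tuple]) /=; last first.
    by move=> n; rewrite (tuple0 n); apply/esym/eqP.
  rewrite big_ord0 mul1r (tuple0 k) /= (bigD1 ord0) //= mul1r big1 ?addr0 //.
  by case=> -[|n] //= ? _; rewrite mul0r.
rewrite sum_tuple_rcons /=.
have [k' [a kE]] :
    exists k' : q.-tuple nat, exists a, k = [tuple of rcons k' a].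
  case/tupleP: k {k_gt0} => k0 k'.
  exists [tuple of belast k0 k'], (last k0 k'); apply: val_inj => /=.
  by rewrite lastI.
have a_gt0 : (0 < a)%N by have := k_gt0 ord_max; rewrite kE tnth_rcons_max.
have k'_gt0 j : (0 < tnth k' j)%N.
  by have := k_gt0 (widen_ord (leqnSn q) j); rewrite kE tnth_rcons_widen.
(* The sum over the last entry, as a function of the entry before it. *)
pose G i := \sum_(e < N.+1 | (i < e)%N) h e ^+ a * g e.
transitivity (\sum_(n : q.-tuple 'I_N.+1 | increasing n)
   (\prod_(j < q) h (tnth n j) ^+ tnth k' j) *
   G (last 0%N [seq val i | i <- n])).
  rewrite [RHS]big_mkcond /=; apply: eq_bigr => n _.
  under eq_bigl do rewrite /increasing /= map_rcons rcons_path.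
  rewrite /increasing.
  case: ifP => _ /=; last by rewrite big_pred0.
  rewrite mulr_sumr; apply: eq_bigr => e _.
  rewrite map_rcons last_rcons big_ord_recr /= kE !tnth_rcons_max -mulrA.
  congr (_ * _).
  by apply: eq_bigr => j _; rewrite !tnth_rcons_widen.
rewrite (IH G k' k'_gt0) kE /=.
under eq_bigr do rewrite mulr_sumr big_mkcond.
rewrite exchange_big; apply: eq_bigr => e _ /=.
rewrite nested_word_rcons //.
rewrite (big_ord_widen N.+1 (nested_sum h (word k'))); last by rewrite ltnW.
rewrite -big_mkcond mulrAC mulr_sumr; apply: eq_bigr => i _.
by rewrite mulrC.
Qed.

Lemma coef_prod (R : comNzRingType) q m (p : 'I_q -> {poly R}) i :
  (i <= m)%N ->
  (\prod_(j < q) p j)`_i =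
  \sum_(d : q.-tuple 'I_m.+1 | (\sum_(j < q) tnth d j)%N == i)
    \prod_(j < q) (p j)`_(tnth d j).
Proof.
elim: q p i => [|q IH] p i im.
  rewrite big_ord0 coef1; case: i im => [|i] im /=.
    rewrite (big_pred1 [tuple]) /= ?big_ord0 // => n.
    by rewrite (tuple0 n) big_ord0; apply/esym/eqP.
  by rewrite big_pred0 // => n; rewrite big_ord0.
rewrite big_ord_recr coefMr sum_tuple_rcons /=.
under [RHS]eq_bigr => d _.
  under eq_bigl => e do (rewrite big_ord_recr /= tnth_rcons_max;
   under eq_bigr do rewrite tnth_rcons_widen).
  under eq_bigr => e _ do (rewrite big_ord_recr /= tnth_rcons_max;
   under eq_bigr do rewrite tnth_rcons_widen).
  rewrite big_mkcond /=.
over.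
rewrite exchange_big /=.
rewrite (big_ord_widen m.+1 (fun e =>
  (\prod_(j < q) p (widen_ord (leqnSn q) j))`_(i - e) * (p ord_max)`_e)) //.
rewrite big_mkcond /=; apply: eq_bigr => e _.
rewrite -big_mkcond /= ltnS; case: (leqP e i) => ei.
  rewrite IH; last by rewrite (leq_trans (leq_subr _ _)).
  rewrite mulr_suml; apply: eq_bigl => d.
  by rewrite -[LHS](eqn_add2r e) subnK.
rewrite big_pred0 // => d; apply/negbTE; rewrite neq_ltn orbC.
by rewrite (leq_trans ei) ?leq_addl.
Qed.

(** * The integrals K_j(c, n) as truncated power series *)

(** Congruence modulo 'X^(m+1): truncated power series are handled as
    polynomials whose coefficients beyond m are irrelevant. *)
Definition eq_trunc (R : comNzRingType) m (p q : {poly R}) :=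
  forall i, (i <= m)%N -> p`_i = q`_i.

Lemma eq_trunc_mul (R : comNzRingType) m (p p' q q' : {poly R}) :
  eq_trunc m p p' -> eq_trunc m q q' -> eq_trunc m (p * q) (p' * q').
Proof.
move=> pp qq i im; rewrite !coefM; apply: eq_bigr => j _.
by rewrite pp ?qq // (leq_trans _ im) ?leq_subr // -ltnS.
Qed.

(** The expansion of 1/(c - 'X) up to order m. *)
Definition inv_trunc (F : fieldType) m (c : F) : {poly F} :=
  \poly_(e < m.+1) c^-1 ^+ e.+1.

Lemma inv_truncP (F : fieldType) m (c : F) : c != 0 ->
  eq_trunc m (inv_trunc m c * (c%:P - 'X)) 1.
Proof.
move=> c0 i im; rewrite mulrBr coefB coefMC coefMX !coef_poly coef1 !ltnS im.
case: i im => [|i] im; first by rewrite subr0 expr1 mulVf.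
by rewrite ltnW // exprSr -mulrA mulVf // mulr1 subrr.
Qed.

Lemma hockey_stick a e : (\sum_(i < e.+1) 'C(a + i - 1, i) = 'C(a + e, e))%N.
Proof.
elim: e => [|e IH]; first by rewrite big_ord_recr big_ord0 /= !bin0.
by rewrite big_ord_recr IH /= addnS subn1 /= addnC -binS.
Qed.

(** The negative binomial series of (c - 'X)^(-a); multiplication by one more
    factor is a hockey-stick summation of binomial coefficients. *)
Lemma coef_inv_truncX (F : fieldType) m (c : F) a e : (e <= m)%N ->
  (inv_trunc m c ^+ a)`_e = 'C(a + e - 1, e)%:R * c^-1 ^+ (a + e).
Proof.
elim: a e => [|a IH] e em.
  rewrite expr0 coef1; case: e em => [|e] em; first by rewrite bin0 mul1r.
  by rewrite add0n bin_small ?mul0r // subn1.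
rewrite exprSr coefM.
under eq_bigr => i _.
  rewrite IH; last by rewrite (leq_trans _ em) // -ltnS.
  rewrite coef_poly ltnS (leq_trans (leq_subr _ _) em) -mulrA -exprD.
  have -> : (a + i + (e - i).+1 = a.+1 + e)%N by have := ltn_ord i; lia.
over.
by rewrite -mulr_suml -natr_sum hockey_stick addSn subn1.
Qed.

(** The generating polynomial of the integrals K_j(c, n), j <= m, computed by
    repeated differences from the values at n = 0; [integral_kernel_fun]
    identifies its coefficients with the integrals. *)
Fixpoint kernel (F : fieldType) m (c : F) n : {poly F} :=
  if n is n'.+1 then kernel m c n' - kernel m (c + 1) n' else inv_trunc m c.

(** Relation (2), divided by c - 'X.  It amounts to an integration by parts,
    but follows algebraically from the recursion by induction on n. *)
Lemma kernel_transport (F : numFieldType) m (c : F) n : 0 < c ->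
  eq_trunc m (kernel m c n.+1)
             (n.+1%:R *: (inv_trunc m c * kernel m (c + 1) n)).
Proof.
move=> c0.
have ibp k : forall b : F, 0 < b ->
    eq_trunc m (kernel m b k.+1 * (b%:P - 'X)) (k.+1%:R *: kernel m (b + 1) k).
  elim: k => [|k IH] b b0 i im.
    have b1 : 0 < b + 1 by rewrite addr_gt0.
    rewrite /=.
    have -> : (inv_trunc m b - inv_trunc m (b + 1)) * (b%:P - 'X) =
        inv_trunc m b * (b%:P - 'X) -
        (inv_trunc m (b + 1) * ((b + 1)%:P - 'X) - inv_trunc m (b + 1)).
      by rewrite polyCD polyC1; ring.
    rewrite coefB inv_truncP ?gt_eqF // coefB inv_truncP ?gt_eqF // scale1r.
    by rewrite opprB addrC subrK.
  have b1 : 0 < b + 1 by rewrite addr_gt0.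
  rewrite [kernel _ _ _]/(kernel m b k.+1 - kernel m (b + 1) k.+1) mulrBl.
  rewrite coefB IH //.
  have -> : kernel m (b + 1) k.+1 * (b%:P - 'X) =
      kernel m (b + 1) k.+1 * ((b + 1)%:P - 'X) - kernel m (b + 1) k.+1.
    by rewrite polyCD polyC1; ring.
  rewrite coefB IH // !coefZ [kernel _ _ k.+1]/= coefB.
  by rewrite -[in RHS]natr1; ring.
move=> i im.
have /(_ i im) := eq_trunc_mul (fun _ _ => erefl)
  (inv_truncP (m := m) (lt0r_neq0 c0)) (p := kernel m c n.+1).
rewrite mulr1 => <-.
rewrite mulrCA scalerAr.
by have /(_ i im) -> := eq_trunc_mul (fun _ _ => erefl) (ibp n c c0)
  (p := inv_trunc m c).
Qed.

(** * The integral of e^(-ct) t^j / j! *)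
Section Laplace.
Variable R : realType.
Implicit Types (c t : R) (j n : nat).

Notation mu := (@lebesgue_measure R).

Definition damped c j t : R := expR (- (c * t)) * t ^+ j / j`!%:R.

(** Integration by parts, unrolled: the derivative of damped c j is
    damped c (j - 1) - c * damped c j. *)
Definition damped_primitive c :=
  fix F j t : R :=
    (if j is j'.+1 then F j' t - damped c j t else - damped c j t) / c.

Lemma damped_ge0 c j t : 0 <= t -> 0 <= damped c j t.
Proof. by move=> t0; rewrite divr_ge0 // mulr_ge0 ?expR_ge0 // exprn_ge0. Qed.

Lemma is_derive_damped c j t :
  is_derive t 1 (damped c j)
    (- c * damped c j t + (if j is j'.+1 then damped c j' t else 0)).
Proof.
have dE : is_derive t 1 (fun t => expR (- (c * t))) (- c * expR (- (c * t))).
  have -> : (fun t => expR (- (c * t))) = expR \o ( *%R (- c)).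
    by apply/funext => u /=; rewrite mulNr.
  have -> : - c * expR (- (c * t)) = expR (- c * t) *: (- c *: (1:R)).
    by rewrite -(mulNr c t) /GRing.scale /= mulr1 mulrC.
  have dl : is_derive t 1 ( *%R (- c)) (- c *: (1:R)) by apply: is_deriveZ.
  have de := is_derive_expR (- c * t).
  exact: is_derive1_comp.
have dX : is_derive t 1 (fun t => t ^+ j) (j%:R * t ^+ j.-1).
  have -> : (fun t : R => t ^+ j) = (id : R -> R) ^+ j.
    by apply/funext => u; rewrite exprfctE.
  by apply: is_derive_eq; rewrite /GRing.scale /= mulr1.
have {1}-> : damped c j =
    (j`!%:R^-1) \*: ((fun t => expR (- (c * t))) * (fun t => t ^+ j)).
  by apply/funext => u; exact: mulrC.
apply: is_derive_eq => /=.
rewrite /damped /GRing.scale /=; case: j dX => [|j] _.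
  rewrite fact0 invr1 !expr0. ring.
rewrite factS natrM /=; field.
rewrite pnatr_eq0 -lt0n fact_gt0 /= (_ : 1 + j%:R = j.+1%:R) ?pnatr_eq0 //.
by rewrite -natr1 addrC.
Qed.

Lemma is_derive_damped_primitive c j t : c != 0 ->
  is_derive t 1 (damped_primitive c j) (damped c j t).
Proof.
move=> c0; elim: j => [|j IH].
  have -> : damped_primitive c 0 = (- c^-1) \*: damped c 0.
    by apply/funext => u /=; rewrite /GRing.scale /= mulNr mulrC mulNr.
  have := is_derive_damped c 0 t => d.
  apply: is_derive_eq.
  by rewrite /GRing.scale /= addr0 mulrA mulrNN mulVf // mul1r.
have -> : damped_primitive c j.+1 =
    c^-1 \*: (damped_primitive c j - damped c j.+1).
  by apply/funext => u /=; rewrite /GRing.scale /= mulrC.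
have := is_derive_damped c j.+1 t => d.
apply: is_derive_eq.
by rewrite /GRing.scale /=; field.
Qed.

(** The exponential dominates t^(j+1): the exponential series bounds
    damped c j t by a multiple of 1/t. *)
Lemma damped_cvg0 c j : 0 < c -> damped c j t @[t --> +oo] --> 0.
Proof.
(* K/t is t^j/j! divided by the term of degree j + 1 of the series of e^(ct). *)
move=> c0; pose K : R := j.+1%:R / c ^+ j.+1.
apply: (@squeeze_cvgr _ _ _ _ (fun=> 0) (fun t => K * t^-1)).
- near=> t.
  have t0 : 0 < t by near: t; exact: nbhs_pinfty_gt.
  rewrite damped_ge0 ?(ltW t0) //= /damped expRN.
  have ct0 : 0 <= c * t by rewrite mulr_ge0 // ltW.
  have /ltW := lt_le_trans (ltr_pwDl ltr01 (lexx _)) (expR_ge1Dxn j ct0).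
  move=> h; have f0 : 0 < j`!%:R :> R by rewrite ltr0n fact_gt0.
  have h0 : 0 < (c * t) ^+ j.+1 / (j.+1)`!%:R.
    by rewrite divr_gt0 ?exprn_gt0 ?mulr_gt0 // ltr0n fact_gt0.
  have -> : K * t^-1 = ((c * t) ^+ j.+1 / (j.+1)`!%:R)^-1 * t ^+ j / j`!%:R.
    rewrite /K exprMn factS natrM !exprS; field.
    rewrite !expf_neq0 ?(lt0r_neq0 c0) ?(lt0r_neq0 t0) // (lt0r_neq0 f0).
    by rewrite addrC natr1 pnatr_eq0.
  rewrite ler_pM2r ?invr_gt0 // ler_pM2r ?exprn_gt0 //.
  by rewrite lef_pV2 // posrE expR_gt0.
- exact: cvg_cst.
- rewrite -(mulr0 K); apply: cvgMr => //.
  apply/gtr0_cvgV0; [exact: nbhs_pinfty_gt|exact: cvg_id].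
Unshelve. all: end_near.
Qed.

Lemma damped_primitive_cvg0 c j : 0 < c ->
  damped_primitive c j t @[t --> +oo] --> 0.
Proof.
move=> c0; elim: j => [|j IH] /=.
  rewrite -(mul0r c^-1) -oppr0; apply: cvgMl; apply: cvgN; exact: damped_cvg0.
rewrite -(mul0r c^-1) -[X in X * _]subr0; apply: cvgMl; apply: cvgB => //.
exact: damped_cvg0.
Qed.

Lemma damped_primitive0 c j : damped_primitive c j 0 = - c^-1 ^+ j.+1.
Proof.
elim: j => [|j IH] /=.
  by rewrite /damped mulr0 oppr0 expR0 expr0 mulr1 fact0 divr1 mulN1r expr1.
by rewrite IH /damped expr0n /= mulr0 mul0r subr0 mulNr -exprSr.
Qed.

Lemma continuous_damped c j : continuous (damped c j).
Proof.
move=> t; have := is_derive_damped c j t => d.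
exact/differentiable_continuous/derivable1_diffP.
Qed.

Lemma measurable_damped c j D : measurable_fun D (damped c j).
Proof.
apply: measurable_funTS.
exact: continuous_measurable_fun (@continuous_damped _ _).
Qed.

Lemma integral_damped c j : 0 < c ->
  (\int[mu]_(t in `]0%R, +oo[) (damped c j t)%:E = (c^-1 ^+ j.+1)%:E)%E.
Proof.
move=> c0; rewrite integral_itv_obnd_cbnd; last first.
  apply/measurable_EFinP; exact: measurable_damped.
rewrite (@ge0_continuous_FTC2y R _ (damped_primitive c j) 0 0).
- by rewrite damped_primitive0 -EFinB sub0r opprK.
- by move=> t; apply: damped_ge0.
- exact: continuous_subspaceT (@continuous_damped _ _).
- exact: damped_primitive_cvg0.
- by move=> t _; have := is_derive_damped_primitive j t (lt0r_neq0 c0) => d.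
- apply: cvg_at_right_filter.
  have := is_derive_damped_primitive j 0 (lt0r_neq0 c0) => d.
  exact/differentiable_continuous/derivable1_diffP.
- move=> t _; have := is_derive_damped_primitive j t (lt0r_neq0 c0) => d.
  by rewrite derive1E derive_val.
Qed.

End Laplace.

(** * Integral representation and summation of the kernel *)
Section Kernel.
Variable R : realType.
Implicit Types (c t : R) (j n m : nat).

Notation mu := (@lebesgue_measure R).

Definition kernel_fun c j n t : R := damped c j t * (1 - expR (- t)) ^+ n.

Lemma kernel_fun_ge0 c j n t : 0 <= t -> 0 <= kernel_fun c j n t.
Proof.
move=> t0; rewrite mulr_ge0 ?damped_ge0 // exprn_ge0 // subr_ge0.
by rewrite -expR0 ler_expR oppr_le0.
Qed.

Lemma measurable_kernel_fun c j n D : measurable_fun D (kernel_fun c j n).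
Proof.
apply: measurable_funM; first exact: measurable_damped.
apply/measurable_funX/measurable_funB => //.
by apply: measurableT_comp => //; exact: measurable_funTS.
Qed.

Lemma dampedS c j t : expR (- t) * damped c j t = damped (c + 1) j t.
Proof. by rewrite /damped !mulrA -expRD mulrDl mul1r opprD addrC. Qed.

(** For n = 0 this is the integral of e^(-ct) t^j/j!.  The splitting
    1 = (1 - e^(-t)) + e^(-t) shows that the integrals satisfy the recursion
    of the kernel. *)
Lemma integral_kernel_fun m c j n : 0 < c -> (j <= m)%N ->
  (\int[mu]_(t in `]0%R, +oo[) (kernel_fun c j n t)%:E =
   ((kernel m c n)`_j)%:E)%E.
Proof.
move=> + jm; elim: n c => [|n IH] c c0.
  rewrite /= coef_poly ltnS jm -integral_damped //.
  by apply: eq_integral => t _; rewrite /kernel_fun expr0 mulr1.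
have c1 : 0 < c + 1 by rewrite addr_gt0.
have := IH c c0.
have -> : (\int[mu]_(t in `]0%R, +oo[) (kernel_fun c j n t)%:E =
  \int[mu]_(t in `]0%R, +oo[) (kernel_fun c j n.+1 t)%:E +
  \int[mu]_(t in `]0%R, +oo[) (kernel_fun (c + 1) j n t)%:E)%E.
  rewrite -ge0_integralD //=.
  - apply: eq_integral => t _; rewrite -EFinD; congr _%:E.
    by rewrite /kernel_fun -dampedS exprS; ring.
  - move=> t; rewrite in_itv /= andbT => /ltW t0.
    by rewrite lee_fin kernel_fun_ge0.
  - by apply/measurable_EFinP; exact: measurable_kernel_fun.
  - move=> t; rewrite in_itv /= andbT => /ltW t0.
    by rewrite lee_fin kernel_fun_ge0.
  - by apply/measurable_EFinP; exact: measurable_kernel_fun.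
rewrite (IH _ c1) coefB EFinB => <-.
by rewrite addeK.
Qed.

Lemma kernel_ge0 m c j n : 0 < c -> (j <= m)%N -> 0 <= (kernel m c n)`_j.
Proof.
move=> c0 jm; rewrite -lee_fin -integral_kernel_fun //.
apply: integral_ge0 => t /=; rewrite in_itv /= andbT => /ltW t0.
by rewrite lee_fin kernel_fun_ge0.
Qed.

Lemma nneseries_geometric (w z : R) : 0 <= z < 1 ->
  (\sum_(i <oo) (w * z ^+ i)%:E = (w / (1 - z))%:E)%E.
Proof.
case/andP => z0 z1.
have zn : `|z| < 1 by rewrite ger0_norm.
have := @cvg_geometric_series R w z zn => h.
apply/cvg_lim => //; under eq_fun do rewrite sumEFin.
by apply/cvg_EFin => //; near=> n.
Unshelve. all: end_near.
Qed.

Lemma expRN_itv t : 0 < t -> 0 < expR (- t) < 1.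
Proof. by move=> t0; rewrite expR_gt0 -expR0 ltr_expR oppr_lt0. Qed.

(** First half of (3): a geometric series in 1 - e^(-t), with sum
    1/e^(-t). *)
Lemma kernel_sum_exponent m c j n : 0 < c -> (j <= m)%N ->
  (\sum_(i <oo) ((kernel m (c + 1) (n + i))`_j)%:E = ((kernel m c n)`_j)%:E)%E.
Proof.
move=> c0 jm; rewrite -integral_kernel_fun //.
have c1 : 0 < c + 1 by rewrite addr_gt0.
under eq_eseriesr do rewrite -integral_kernel_fun //.
rewrite -integral_nneseries //=; last 2 first.
- by move=> i; apply/measurable_EFinP; exact: measurable_kernel_fun.
- move=> i t; rewrite in_itv /= andbT => /ltW t0.
  by rewrite lee_fin kernel_fun_ge0.
apply: eq_integral => t; rewrite inE /= in_itv /= andbT => t0.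
have /andP[e0 e1] := expRN_itv t0.
rewrite /kernel_fun; under eq_eseriesr do rewrite exprD mulrA.
rewrite nneseries_geometric; last first.
  by rewrite subr_ge0 (ltW e1) /= ltrBlDr ltrDl.
rewrite -dampedS subKr; congr _%:E; field.
by rewrite gt_eqF.
Qed.

(** Second half of (3): a geometric series in e^(-t), with sum
    1/(1 - e^(-t)). *)
Lemma kernel_sum_shift m c j n : 0 < c -> (j <= m)%N ->
  (\sum_(i <oo) ((kernel m (c + i%:R) n.+1)`_j)%:E = ((kernel m c n)`_j)%:E)%E.
Proof.
move=> c0 jm; rewrite -integral_kernel_fun //.
have ci i : 0 < c + i%:R by rewrite ltr_wpDr.
under eq_eseriesr do rewrite -integral_kernel_fun //.
rewrite -integral_nneseries //=; last 2 first.
- by move=> i; apply/measurable_EFinP; exact: measurable_kernel_fun.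
- move=> i t; rewrite in_itv /= andbT => /ltW t0.
  by rewrite lee_fin kernel_fun_ge0.
apply: eq_integral => t; rewrite inE /= in_itv /= andbT => t0.
have /andP[e0 e1] := expRN_itv t0.
under eq_eseriesr => i _.
  have -> : kernel_fun (c + i%:R) j n.+1 t =
      kernel_fun c j n.+1 t * expR (- t) ^+ i.
    rewrite /kernel_fun [RHS]mulrAC; congr (_ * _); rewrite [RHS]mulrC.
    elim: i => [|i IHi]; first by rewrite addr0 expr0 mul1r.
    by rewrite -natr1 addrA -dampedS IHi exprS mulrA.
over.
rewrite nneseries_geometric ?(ltW e0) // /kernel_fun exprSr mulrA mulfK //.
by rewrite subr_eq0 gt_eqF.
Qed.

Definition coef_nneg m (p : {poly R}) := forall j, (j <= m)%N -> 0 <= p`_j.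

Lemma coef_nnegM m p q : coef_nneg m p -> coef_nneg m q -> coef_nneg m (p * q).
Proof.
move=> p0 q0 j jm; rewrite coefM; apply: sumr_ge0 => i _.
by rewrite mulr_ge0 ?p0 ?q0 // (leq_trans _ jm) ?leq_subr // -ltnS.
Qed.

Lemma kernel_nneg m c n : 0 < c -> coef_nneg m (kernel m c n).
Proof. by move=> c0 j jm; exact: kernel_ge0. Qed.

(** A series that is summed coefficientwise up to order m may be multiplied by
    a fixed polynomial; nonnegative coefficients make all the series involved
    meaningful in the extended reals. *)
Lemma nneseries_coefM m (p q : {poly R}) (r : nat -> {poly R}) :
  coef_nneg m p -> (forall i, coef_nneg m (r i)) ->
  (forall j, (j <= m)%N -> (\sum_(i <oo) ((r i)`_j)%:E = (q`_j)%:E)%E) ->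
  (\sum_(i <oo) ((p * r i)`_m)%:E = ((p * q)`_m)%:E)%E.
Proof.
move=> p0 r0 rq; rewrite coefM -sumEFin.
under eq_eseriesr do rewrite coefM -sumEFin.
rewrite nneseries_sum; last first.
  move=> j i _; have := ltn_ord j; rewrite ltnS => jm.
  by rewrite lee_fin mulr_ge0 ?p0 ?r0 // leq_subr.
apply: eq_bigr => j _; rewrite EFinM -(rq _ (leq_subr _ _)) -nneseriesZl //.
by move=> i _; rewrite lee_fin r0 // leq_subr.
Qed.

End Kernel.

(** * Series of nonnegative extended reals *)
Section Series.
Variable R : realType.
Implicit Types (f : nat -> \bar R) (g : nat -> nat -> \bar R).
Local Open Scope ereal_scope.

Lemma nneseries_behead f : (forall n, 0 <= f n) -> f 0%N = 0 ->
  \sum_(n <oo) f n = \sum_(n <oo) f n.+1.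
Proof.
move=> f0 f00; rewrite nneseries_recl // f00 add0e -(nneseries_addn 1) //.
by apply: eq_eseriesr => n _; rewrite addn1.
Qed.

Lemma nneseries_head f : (forall n, f n.+1 = 0) -> 0 <= f 0%N ->
  \sum_(n <oo) f n = f 0%N.
Proof.
move=> f0 f00; rewrite nneseries_recl //; last by case=> [|n] _; rewrite ?f0.
by rewrite eseries0 ?adde0 // => -[|n].
Qed.

(** Summation over the pairs i <= j, by rows and by columns. *)
Lemma nneseries_triangle g : (forall i j, 0 <= g i j) ->
  \sum_(i <oo) \sum_(j <oo) g i (j + i)%N = \sum_(j <oo) \sum_(i < j.+1) g i j.
Proof.
move=> g0; transitivity
  (\sum_(i <oo) \sum_(j <oo) (if (i <= j)%N then g i j else 0)).
  apply: eq_eseriesr => i _; rewrite (nneseries_addn i (f := g i)) //.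
  by rewrite eseries_cond eseries_mkcond.
rewrite nneseries_interchange; last by move=> i j; case: ifP.
apply: eq_eseriesr => j _.
rewrite (nneseries_split 0 j.+1) ?add0n; last by move=> i _; case: ifP.
rewrite [X in _ + X]eseries0 ?adde0; last first.
  by move=> i ji _; rewrite leqNgt ji.
rewrite big_mkord; apply: eq_bigr => i _.
by rewrite -ltnS ltn_ord.
Qed.

End Series.

(** * Transport of letters through the connected sum *)
Section Transport.
Variables (R : realType) (x : R) (m : nat).
Hypothesis x1_gt0 : 0 < x + 1.

(** The expansion of 1/(n + x - 'X) up to order m. *)
Definition weight (n : nat) : {poly R} := inv_trunc m (n%:R + x).

Definition harmonic (n : nat) : R := n%:R^-1.

(** The summation index k of the inner variable is shifted by one, because
    n + x is known to be positive for n > 0 only. *)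
Definition connected_sum (b : nat -> {poly R}) (a : nat -> R) : \bar R :=
  (\sum_(k <oo) \sum_(n <oo)
     (a n * (b k.+1 * kernel m (k.+1%:R + x) n)`_m)%:E)%E.

Definition cumul (b : nat -> {poly R}) (n : nat) := \sum_(i < n) b i.

Lemma shift_gt0 k : 0 < k.+1%:R + x.
Proof. by rewrite -natr1 -addrA ltr_wpDl // addrC. Qed.

Lemma connected_term_ge0 (c : R) (r : R) (p : {poly R}) n : 0 < c -> 0 <= r ->
  coef_nneg m p -> (0 <= (r * (p * kernel m c n)`_m)%:E)%E.
Proof.
move=> c0 r0 p0; rewrite lee_fin mulr_ge0 //.
by apply: (coef_nnegM p0 _ (leqnn m)); exact: kernel_nneg.
Qed.

Lemma coef_nneg0 : coef_nneg m (0 : {poly R}).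
Proof. by move=> j _; rewrite coef0. Qed.

Lemma coef_nneg_sum (I : finType) (P : pred I) (F : I -> {poly R}) :
  (forall i, P i -> coef_nneg m (F i)) -> coef_nneg m (\sum_(i | P i) F i).
Proof. by move=> F0 j jm; rewrite coef_sum sumr_ge0 // => i Pi; exact: F0. Qed.

Lemma weight_nneg k : coef_nneg m (weight k.+1).
Proof. exact: (@kernel_nneg R m _ 0 (shift_gt0 k)). Qed.

(** Each kernel is expanded into a series over larger first arguments, by
    [kernel_sum_shift]; exchanging the sums accumulates b. *)
Lemma connected_sum_cumul b a :
  (forall k, coef_nneg m (b k)) -> (forall n, 0 <= a n) -> a 0%N = 0 ->
  (\sum_(k <oo) \sum_(n <oo)
     (a n.+1 * (b k * kernel m (k.+1%:R + x) n)`_m)%:E)%E =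
  connected_sum (cumul b) a.
Proof.
move=> b0 a0 a00.
have kE k n : ((a n.+1 * (b k * kernel m (k.+1%:R + x) n)`_m)%:E =
    \sum_(i <oo) (a n.+1 * (b k * kernel m ((i + k).+1%:R + x) n.+1)`_m)%:E)%E.
  under [RHS]eq_eseriesr do rewrite EFinM.
  rewrite nneseriesZl; last first.
    move=> i _; rewrite -[X in X%:E]mul1r; apply: connected_term_ge0 => //.
    exact: shift_gt0.
  rewrite EFinM; congr *%E; apply/esym/nneseries_coefM => //.
    by move=> i; apply: kernel_nneg; exact: shift_gt0.
  move=> j jm; rewrite -(kernel_sum_shift n (shift_gt0 k) jm).
  apply: eq_eseriesr => i _; congr ((kernel m _ _)`_ _)%:E.
  by rewrite -addnS addnC natrD addrAC.
under eq_eseriesr do under eq_eseriesr do rewrite kE.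
have t0 n k K : (0 <= (a n * (b k * kernel m (K.+1%:R + x) n)`_m)%:E)%E.
  by apply: connected_term_ge0 => //; exact: shift_gt0.
rewrite nneseries_interchange; last first.
  by move=> k n; apply: nneseries_ge0 => i _ _; exact: t0.
under eq_eseriesr => n _ do rewrite (nneseries_triangle
   (g := fun k K => (a n.+1 * (b k * kernel m (K.+1%:R + x) n.+1)`_m)%:E)) //.
rewrite /connected_sum nneseries_interchange; last first.
  by move=> n K; apply: sume_ge0 => i _; exact: t0.
apply: eq_eseriesr => K _.
rewrite [RHS]nneseries_behead ?a00 ?mul0r //; last first.
  move=> n; apply: connected_term_ge0 => //; first exact: shift_gt0.
  by apply: coef_nneg_sum => i _; exact: b0.
apply: eq_eseriesr => n _; rewrite sumEFin /cumul.
by rewrite -mulr_sumr mulr_suml coef_sum.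
Qed.

(** [kernel_transport], in the form needed inside a connected sum. *)
Lemma harmonic_kernel b a k n :
  harmonic n.+1 * a * (b * kernel m (k.+1%:R + x) n.+1)`_m =
  a * (weight k.+1 * b * kernel m (k.+2%:R + x) n)`_m.
Proof.
have /(_ m (leqnn m)) -> := eq_trunc_mul (fun _ _ => erefl)
  (kernel_transport (m := m) n (shift_gt0 k)) (p := b).
rewrite -scalerAr coefZ /harmonic mulrCA !mulrA mulfV ?pnatr_eq0 // mul1r.
have -> : k.+1%:R + x + 1 = k.+2%:R + x by rewrite -(natr1 k.+1) addrAC.
by rewrite /weight (mulrC _ b).
Qed.

(** A factor 1/n becomes a factor [weight] by [harmonic_kernel], and the shift
    of the kernel is absorbed by a summation on the side of b. *)
Lemma connected_sum_false b a :
  (forall k, coef_nneg m (b k)) -> b 0%N = 0 ->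
  (forall n, 0 <= a n) -> a 0%N = 0 ->
  connected_sum b (nested_step harmonic a false) =
  connected_sum (cumul (fun k => weight k * b k)) a.
Proof.
move=> b0 b00 a0 a00.
have wb0 k : coef_nneg m (weight k * b k).
  case: k => [|k]; first by rewrite b00 mulr0; exact: coef_nneg0.
  by apply: coef_nnegM => //; exact: weight_nneg.
have s0 n : 0 <= nested_step harmonic a false n.
  by rewrite mulr_ge0 // invr_ge0.
rewrite -connected_sum_cumul // [RHS]nneseries_behead; last 2 first.
- move=> k; apply: nneseries_ge0 => n _ _; apply: connected_term_ge0 => //.
  exact: shift_gt0.
- by rewrite eseries0 // => n _ _; rewrite b00 mulr0 mul0r coef0 mulr0.
apply: eq_eseriesr => k _; rewrite nneseries_behead; last 2 first.
- by move=> n; apply: connected_term_ge0 => //; exact: shift_gt0.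
- by rewrite /nested_step a00 mulr0 mul0r.
by apply: eq_eseriesr => n _; rewrite harmonic_kernel.
Qed.

(** A factor 1/n becomes a factor [weight] as before, and here the shift of the
    kernel cancels the summation on the side of a, by [kernel_sum_exponent]. *)
Lemma connected_sum_true b a :
  (forall k, coef_nneg m (b k)) -> (forall n, 0 <= a n) ->
  connected_sum b (nested_step harmonic a true) =
  connected_sum (fun k => weight k * b k) a.
Proof.
move=> b0 a0.
have s0 n : 0 <= nested_step harmonic a true n.
  by rewrite mulr_ge0 ?invr_ge0 // sumr_ge0.
have wb0 k : coef_nneg m (weight k.+1 * b k.+1).
  by apply: coef_nnegM => //; exact: weight_nneg.
apply: eq_eseriesr => k _; rewrite nneseries_behead; last 2 first.
- by move=> n; apply: connected_term_ge0 => //; exact: shift_gt0.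
- by rewrite /nested_step big_ord0 mulr0 mul0r.
have t0 i n : (0 <=
    (a i * (weight k.+1 * b k.+1 * kernel m (k.+2%:R + x) n)`_m)%:E)%E.
  by apply: connected_term_ge0 => //; exact: shift_gt0.
transitivity (\sum_(n <oo) \sum_(i < n.+1)
   (a i * (weight k.+1 * b k.+1 * kernel m (k.+2%:R + x) n)`_m)%:E)%E.
  apply: eq_eseriesr => n _; rewrite /nested_step harmonic_kernel.
  by rewrite mulr_suml sumEFin.
rewrite -(nneseries_triangle
  (g := fun i n =>
     (a i * (weight k.+1 * b k.+1 * kernel m (k.+2%:R + x) n)`_m)%:E)) //.
apply: eq_eseriesr => i _.
under eq_eseriesr do rewrite EFinM.
rewrite nneseriesZl; last first.
  move=> j _; rewrite -[X in X%:E]mul1r; apply: connected_term_ge0 => //.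
  exact: shift_gt0.
rewrite EFinM; congr *%E; apply: nneseries_coefM => //.
  by move=> j; apply: kernel_nneg; exact: shift_gt0.
move=> j jm; rewrite -(kernel_sum_exponent i (shift_gt0 k) jm).
apply: eq_eseriesr => n _; congr ((kernel m _ _)`_ _)%:E; last exact: addnC.
by rewrite -(natr1 k.+1) addrAC.
Qed.

Lemma nested_harmonic_ge0 w n : 0 <= nested_sum harmonic w n.
Proof.
elim/last_ind: w n => [|w l IH] n; first by rewrite ler0n.
rewrite nested_rcons mulr_ge0 ?invr_ge0 //.
by case: l => //; exact: sumr_ge0.
Qed.

(** Induction on the last letter of w.  The letter true multiplies b by
    [weight], which is the effect of the letter false on the other side, and
    conversely.  The hypothesis on the first letter provides the vanishing at
    n = 0 under which letters false are transported. *)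
Lemma connected_sum_transport b w :
  (forall k, coef_nneg m (b k)) -> b 0%N = 0 -> head true w ->
  connected_sum b (nested_sum harmonic w) =
  (\sum_(k <oo) ((foldl (nested_step weight) (fun k => weight k * b k)
      (rev (map negb w)) k.+1)`_m)%:E)%E.
Proof.
elim/last_ind: w b => [|w l IH] b b0 b00 hw.
  apply: eq_eseriesr => k _.
  rewrite nneseries_head; first by rewrite mul1r mulrC.
    by move=> n; rewrite mul0r.
  by apply: connected_term_ge0 => //; exact: shift_gt0.
have hw' : head true w by case: w hw {IH}.
have wb0 k : coef_nneg m (weight k * b k).
  case: k => [|k]; first by rewrite b00 mulr0; exact: coef_nneg0.
  by apply: coef_nnegM => //; exact: weight_nneg.
rewrite map_rcons rev_rcons nested_rcons; case: l hw => hw.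
  rewrite connected_sum_true //; last exact: nested_harmonic_ge0.
  by rewrite IH // b00 mulr0.
rewrite connected_sum_false //; last 2 first.
- exact: nested_harmonic_ge0.
- by case: w hw hw' {IH} => // -[] w //= _ _; rewrite nested_true0.
rewrite IH //.
  by move=> k; apply: coef_nneg_sum => i _.
by rewrite /cumul big_ord0.
Qed.

End Transport.

(** * Duality of the nested series *)
Lemma index_of_blocks_admissible c :
  all (leq 1) (index_of_blocks c) /\
  (c != [::] -> (1 < last 0 (index_of_blocks c))%N).
Proof.
elim: c => // -[a b] c [IH1 IH2]; rewrite /index_of_blocks /=; split.
  rewrite all_cat IH1 andbT all_rcons /=.
  by elim: a {IH1 IH2}.
move=> _; case: c IH1 IH2 => [|d c] _ IH2; first by rewrite /= cats0 last_rcons.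
rewrite last_cat last_rcons; have := IH2 isT; rewrite /index_of_blocks.
by case: (flatten _).
Qed.

(** The last entry of an index made of blocks is at least 2, so that it stays
    positive when the increment is undone. *)
Lemma dual_index_gt0 k b : b != [::] -> dual_index k (incr_last b) ->
  all (leq 1) b.
Proof.
case/lastP: b => // b z _ [c _]; rewrite incr_last_rcons.
set c' := rev _ => bE; have [h1 h2] := index_of_blocks_admissible c'.
have c'0 : c' != [::] by apply/eqP => e; move: bE; rewrite e /=; case: (b).
move: h1 (h2 c'0); rewrite -bE last_rcons !all_rcons => /andP[_ ->].
by rewrite ltnS andbT.
Qed.

Section Duality.
Variables (R : realType) (x : R) (m : nat).
Hypothesis x1_gt0 : 0 < x + 1.

(** The left-hand side becomes a connected sum by [connected_sum_cumul],
    applied to the indicator b0 of 0; the letter true thereby created on the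
    side of b is the opposite of the last letter false in the word of
    (beta_1, ..., beta_r + 1). *)
Lemma nested_duality (alpha beta : seq nat) :
  alpha != [::] -> all (leq 1) alpha -> beta != [::] -> all (leq 1) beta ->
  dual_index (incr_last alpha) (incr_last beta) ->
  (\sum_(n <oo)
     (nested_sum (@harmonic R) (word beta) n.+1 * (kernel m (1 + x) n)`_m)%:E =
   \sum_(k <oo)
     ((nested_sum (weight x m) (word alpha) k.+1 * weight x m k.+1)`_m)%:E)%E.
Proof.
move=> alpha0 alpha1 beta0 beta1 /word_dual.
rewrite !word_incr_last // map_rcons rev_rcons /= => dual.
have hd : head true (word beta) by case: (beta) beta0.
(* The sum over k collapses to k = 0, where the kernel is K(1 + x, n). *)
pose b0 (k : nat) : {poly R} := (k == 0%N)%:R.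
have b0_nneg k : coef_nneg m (b0 k).
  by rewrite /b0; case: k => [|k] j _; rewrite ?coef1 ?coef0 // ler0n.
have word0 : nested_sum (@harmonic R) (word beta) 0 = 0.
  by case: (beta) beta0 => // b s _; rewrite nested_true0.
transitivity
  (connected_sum x m (cumul b0) (nested_sum (@harmonic R) (word beta))).
  rewrite -connected_sum_cumul //; last exact: nested_harmonic_ge0.
  rewrite [RHS]nneseries_head.
  - by apply: eq_eseriesr => n _; rewrite mul1r.
  - by move=> k; rewrite eseries0 // => n _ _; rewrite /b0 mul0r coef0 mulr0.
  - apply: nneseries_ge0 => n _ _; apply: connected_term_ge0 => //.
      by rewrite addrC.
    exact: nested_harmonic_ge0.
rewrite connected_sum_transport //; last 2 first.
- by move=> k; apply: coef_nneg_sum => i _.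
- by rewrite /cumul big_ord0.
apply: eq_eseriesr => k _; congr (_`_m)%:E.
transitivity (nested_sum (weight x m) (rcons (word alpha) false) k.+1).
  by rewrite -dual.
by rewrite nested_rcons mulrC.
Qed.

End Duality.

(** * Convergence of multiple zeta values *)
Section MultipleZeta.
Variables (R : realType) (x : R).
Hypothesis x1_gt0 : 0 < x + 1.

Definition hurwitz (n : nat) : R := (n%:R + x)^-1.

Lemma hurwitz_ge0 n : 0 <= hurwitz n.+1.
Proof. by rewrite invr_ge0 ltW // shift_gt0. Qed.

Lemma nested_hurwitz_ge0 w n : 0 <= nested_sum hurwitz (true :: w) n.
Proof.
elim/last_ind: w n => [|w l IH] n.
  rewrite /nested_sum /= /nested_step.
  case: n => [|n]; first by rewrite big_ord0 mulr0.
  by rewrite mulr_ge0 ?hurwitz_ge0 // sumr_ge0.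
case: n => [|n]; first by rewrite -rcons_cons nested_true0.
rewrite -rcons_cons nested_rcons mulr_ge0 ?hurwitz_ge0 //.
by case: l => //; exact: sumr_ge0.
Qed.

(** Telescoping: 1/(a + 1)^2 <= 1/a - 1/(a + 1). *)
Lemma hurwitz_sqr_tail i d :
  \sum_(n < d) hurwitz (i + n).+2 ^+ 2 <= hurwitz i.+1.
Proof.
have h n : hurwitz n.+2 ^+ 2 <= hurwitz n.+1 - hurwitz n.+2.
  rewrite /hurwitz; have a0 := shift_gt0 x1_gt0 n.
  have -> : n.+2%:R + x = n.+1%:R + x + 1 by rewrite -(natr1 n.+1) addrAC.
  set a := _ + x in a0 *.
  have -> : a^-1 - (a + 1)^-1 = a^-1 * (a + 1)^-1.
    by field; rewrite !gt_eqF // addr_gt0.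
  have a1 : 0 < a + 1 by rewrite addr_gt0.
  rewrite expr2 ler_pM2r ?invr_gt0 // lef_pV2 ?posrE // lerDl //.
apply: (@le_trans _ _ (hurwitz i.+1 - hurwitz (i + d).+1)); last first.
  by rewrite lerBlDr lerDl hurwitz_ge0.
elim: d => [|d IH]; first by rewrite big_ord0 addn0 subrr.
rewrite big_ord_recr /= addnS; apply: le_trans (lerD IH (h _)) _.
by rewrite addrA subrK.
Qed.

(** The worst case has all exponents 1 except the last, which is 2.  By
    [hurwitz_sqr_tail] the sum over the largest variable is bounded by the
    reciprocal of the next one, which lowers the depth by one.  A letter false
    costs the constant factor 1/(1 + x). *)
Lemma nested_hurwitz_bounded w : exists C, forall N,
  \sum_(n < N) nested_sum hurwitz (true :: w) n * hurwitz n <= C.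
Proof.
elim/last_ind: w => [|w l [C IH]].
  exists (hurwitz 1 ^+ 2 + hurwitz 1) => N.
  have nE n :
      nested_sum hurwitz [:: true] n.+1 * hurwitz n.+1 = hurwitz n.+1 ^+ 2.
    rewrite /nested_sum /= /nested_step big_ord_recl /= big1 //.
    by rewrite addr0 mulr1 expr2.
  have C0 : 0 <= hurwitz 1 ^+ 2 by rewrite exprn_ge0 ?hurwitz_ge0.
  case: N => [|N]; first by rewrite big_ord0 addr_ge0 ?hurwitz_ge0.
  rewrite big_ord_recl nested_true0 mul0r add0r.
  under eq_bigr do rewrite nE.
  case: N => [|N]; first by rewrite big_ord0 addr_ge0 ?hurwitz_ge0.
  rewrite big_ord_recl lerD2l.
  exact: (hurwitz_sqr_tail 0 N).
case: l; last first.
  exists (hurwitz 1 * C) => N.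
  apply: le_trans (ler_wpM2l (hurwitz_ge0 0) (IH N)).
  rewrite mulr_sumr; apply: ler_sum => -[[|n] /= _] _.
    by rewrite -rcons_cons !nested_true0 !mul0r mulr0.
  rewrite -rcons_cons nested_rcons /nested_step -mulrA.
  apply: ler_wpM2r.
    by rewrite mulr_ge0 ?hurwitz_ge0 // nested_hurwitz_ge0.
  by rewrite /hurwitz lef_pV2 ?posrE ?shift_gt0 // lerD2r ler_nat.
exists C => N; apply: le_trans (IH N).
set f := nested_sum hurwitz (true :: w).
have -> : \sum_(n < N) nested_sum hurwitz (true :: rcons w true) n * hurwitz n =
    \sum_(i < N) f i * \sum_(n < N | (i < n)%N) hurwitz n ^+ 2.
  under [RHS]eq_bigr do rewrite mulr_sumr big_mkcond.
  rewrite exchange_big; apply: eq_bigr => n _ /=.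
  rewrite -rcons_cons nested_rcons /nested_step -/f mulrAC -expr2 mulr_sumr.
  rewrite (big_ord_widen N (fun i => hurwitz n ^+ 2 * f i));
    last by rewrite ltnW.
  by rewrite big_mkcond; apply: eq_bigr => i _; rewrite mulrC.
apply: ler_sum => -[[|i] /= iN] _; first by rewrite /f nested_true0 !mul0r.
apply: ler_wpM2l; first exact: nested_hurwitz_ge0.
have := @big_geq_mkord _ 0 +%R i.+2 N xpredT (fun n => hurwitz n ^+ 2).
move=> /= <-; rewrite -[i.+2]add0n big_addn big_mkord.
apply: le_trans (hurwitz_sqr_tail i (N - i.+2)).
by apply: ler_sum => n _; rewrite !addnS addnC.
Qed.

Lemma nested_hurwitz_expr w e n :
  nested_sum hurwitz (w ++ nseq e false) n =
  nested_sum hurwitz w n * hurwitz n ^+ e.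
Proof.
elim: e => [|e IH]; first by rewrite cats0 mulr1.
rewrite -rcons_nseq -rcons_cat nested_rcons /nested_step IH exprS.
by rewrite mulrCA.
Qed.

Lemma is_cvg_nested_hurwitz w e : cvgn (fun N : nat =>
  \sum_(n < N) nested_sum hurwitz (true :: w) n * hurwitz n ^+ e.+1).
Proof.
have [C hC] := nested_hurwitz_bounded (w ++ nseq e false).
apply: nondecreasing_is_cvgn.
  apply/nondecreasing_seqP => N; rewrite big_ord_recr /= lerDl.
  case: N => [|N]; first by rewrite nested_true0 mul0r.
  by rewrite mulr_ge0 ?nested_hurwitz_ge0 // exprn_ge0 ?hurwitz_ge0.
exists C => _ [N _ <-]; apply: le_trans (hC N).
by apply: ler_sum => n _; rewrite -cat_cons nested_hurwitz_expr exprSr mulrA.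
Qed.

Lemma prod_incr_last (S : comNzRingType) q N (n : q.-tuple 'I_N.+1)
    (h : nat -> S) (k : 'I_q -> nat) e : (0 < q)%N ->
  \prod_(j < q) h (tnth n j) ^+ (k j + (if j.+1 == q then e else 0)) =
  (\prod_(j < q) h (tnth n j) ^+ k j) * h (last 0%N [seq val i | i <- n]) ^+ e.
Proof.
case: q n k => // q n k _.
under eq_bigr do rewrite exprD.
rewrite big_split /=; congr (_ * _).
rewrite (bigD1 ord_max) //= eqxx big1 ?mulr1; last first.
  move=> j jmax; rewrite eqSS ifN //.
rewrite (tnth_nth ord0) /= -nth_last size_map size_tuple /=.
by rewrite (nth_map ord0) ?size_tuple.
Qed.

Lemma is_cvg_mzeta q (k : q.-tuple nat) e : (0 < q)%N ->
  (forall j, 0 < tnth k j)%N ->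
  cvgn (fun N : nat => \sum_(n : q.-tuple 'I_N.+1 | increasing n)
    \prod_(j < q) ((tnth n j)%:R + x) ^-
      (tnth k j + (if j.+1 == q then e.+1 else 0))).
Proof.
move=> q0 k0.
have -> : (fun N : nat => \sum_(n : q.-tuple 'I_N.+1 | increasing n)
    \prod_(j < q) ((tnth n j)%:R + x) ^-
      (tnth k j + (if j.+1 == q then e.+1 else 0))) =
    (fun N =>
       \sum_(n < N.+1) nested_sum hurwitz (word k) n * hurwitz n ^+ e.+1).
  apply/funext => N.
  rewrite -(sum_increasing hurwitz (fun n => hurwitz n ^+ e.+1)) //.
  apply: eq_bigr => n _.
  rewrite -prod_incr_last //; apply: eq_bigr => j _.
  by rewrite -exprVn.
have [w ->] : exists w, word k = true :: w.
  case: (tval k) (size_tuple k) => [q0'|a k' _].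
    by rewrite -q0' in q0.
  by eexists.
have /cvg_ex [l hl] := @is_cvg_nested_hurwitz w e.
apply/cvg_ex; exists l.
by have := hl; rewrite -(cvg_shiftS (fun N =>
  \sum_(n < N) nested_sum hurwitz (true :: w) n * hurwitz n ^+ e.+1)).
Qed.

End MultipleZeta.

(** * Expansion in the auxiliary variable *)
Section Expansion.
Variables (R : realType) (x : R) (m : nat).

(** The coefficient of 'X^m in a product of q + 1 negative binomial series.
    The last factor has exponent 1, hence trivial binomial coefficients, and is
    based at the same integer n_q as the factor before it. *)
Lemma coef_weight_prod q (alpha : q.-tuple nat) N (n : q.-tuple 'I_N.+1) :
  (0 < q)%N ->
  ((\prod_(j < q) weight x m (tnth n j) ^+ tnth alpha j)
     * weight x m (last 0%N [seq val i | i <- n]))`_m =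
  \sum_(d : q.+1.-tuple 'I_m.+1 | (\sum_(i < q.+1) tnth d i)%N == m)
    (Mcoef alpha d)%:R *
    \prod_(j < q) ((tnth n j)%:R + x) ^- tnth (shifted_index alpha d) j.
Proof.
move=> q0; set l := last _ _.
(* The extra factor is put at index q, where [insub] fails. *)
pose p (i : 'I_q.+1) := if insub (val i) is Some j
  then weight x m (tnth n j) ^+ tnth alpha j else weight x m l ^+ 1.
have pj (j : 'I_q) :
    p (widen_ord (leqnSn q) j) = weight x m (tnth n j) ^+ tnth alpha j.
  by rewrite /p valK.
have pq : p ord_max = weight x m l ^+ 1 by rewrite /p insubN // ltnn.
transitivity ((\prod_i p i)`_m).
  by rewrite big_ord_recr /= pq expr1; under [in RHS]eq_bigr do rewrite pj.
rewrite (coef_prod _ (leqnn m)); apply: eq_bigr => d _.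
have dm i : (tnth d i <= m)%N by rewrite -ltnS.
rewrite big_ord_recr /= pq coef_inv_truncX // addKn binn mul1r.
under eq_bigr do rewrite pj coef_inv_truncX //.
rewrite big_split /= -mulrA; congr (_ * _); first by rewrite /Mcoef natr_prod.
rewrite addnC -[(_ + 1)%N]/(tnth d ord_max + 1)%N.
rewrite -(prod_incr_last n (fun i => (i%:R + x)^-1)
   (fun j => (tnth alpha j + tnth d (widen_ord (leqnSn q) j))%N)) //.
by apply: eq_bigr => j _; rewrite tnth_mktuple exprVn.
Qed.

Lemma sum_nested_weight q (alpha : q.-tuple nat) N : (0 < q)%N ->
  (forall j, 0 < tnth alpha j)%N ->
  \sum_(n < N.+1) (nested_sum (weight x m) (word alpha) n * weight x m n)`_m =
  \sum_(d : q.+1.-tuple 'I_m.+1 | (\sum_(i < q.+1) tnth d i)%N == m)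
    (Mcoef alpha d)%:R *
    \sum_(n : q.-tuple 'I_N.+1 | increasing n)
      \prod_(j < q) ((tnth n j)%:R + x) ^- tnth (shifted_index alpha d) j.
Proof.
move=> q0 a0; rewrite -coef_sum -sum_increasing // coef_sum.
under [RHS]eq_bigr do rewrite mulr_sumr.
by rewrite exchange_big; apply: eq_bigr => n _; rewrite coef_weight_prod.
Qed.

Hypothesis x1_gt0 : 0 < x + 1.

Lemma nneseries_nested_weight q (alpha : q.-tuple nat) : (0 < q)%N ->
  (forall j, 0 < tnth alpha j)%N ->
  (\sum_(k <oo)
     ((nested_sum (weight x m) (word alpha) k.+1 * weight x m k.+1)`_m)%:E =
  (\sum_(d : q.+1.-tuple 'I_m.+1 | (\sum_(i < q.+1) tnth d i)%N == m)
    (Mcoef alpha d)%:R * mzeta (shifted_index alpha d) x)%:E)%E.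
Proof.
move=> q0 a0; apply/cvg_lim => //; under eq_fun do rewrite sumEFin.
apply/cvg_EFin; first by near=> N.
have h0 : nested_sum (weight x m) (word alpha) 0 = 0.
  case: (tval alpha) (size_tuple alpha) => [q0'|a k' _].
    by rewrite -q0' in q0.
  by rewrite nested_true0.
have -> : fine \o (fun N : nat => (\sum_(0 <= k < N)
     (nested_sum (weight x m) (word alpha) k.+1 * weight x m k.+1)`_m)%:E) =
   (fun N => \sum_(d : q.+1.-tuple 'I_m.+1 | (\sum_(i < q.+1) tnth d i)%N == m)
    (Mcoef alpha d)%:R *
    \sum_(n : q.-tuple 'I_N.+1 | increasing n)
      \prod_(j < q) ((tnth n j)%:R + x) ^- tnth (shifted_index alpha d) j).
  apply/funext => N /=; rewrite -sum_nested_weight // big_ord_recl h0.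
  by rewrite mul0r coef0 add0r big_mkord.
apply: cvg_big => [|d _]; first exact: add_continuous.
apply: cvgMr.
pose k := [tuple (tnth alpha j + initial d j)%N | j < q].
have k0 j : (0 < tnth k j)%N by rewrite tnth_mktuple addn_gt0 a0.
have := is_cvg_mzeta x1_gt0 (e := tnth d ord_max) q0 k0.
have kE : forall N : nat,
  \sum_(n : q.-tuple 'I_N.+1 | increasing n)
    \prod_(j < q) ((tnth n j)%:R + x) ^-
      (tnth k j + (if j.+1 == q then (tnth d ord_max).+1 else 0)) =
  \sum_(n : q.-tuple 'I_N.+1 | increasing n)
      \prod_(j < q) ((tnth n j)%:R + x) ^- tnth (shifted_index alpha d) j.
  move=> N; apply: eq_bigr => n _; apply: eq_bigr => j _.
  by rewrite !tnth_mktuple addn1.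
by under eq_fun do rewrite kE.
Unshelve. all: end_near.
Qed.

End Expansion.

(** * The integral of the polylogarithm *)
Section Polylogarithm.
Variables (R : realType) (r : nat) (beta : r.-tuple nat).
Hypotheses (r_gt0 : (0 < r)%N) (beta_gt0 : forall j, (0 < tnth beta j)%N).

(** The letter true takes the average of the preceding values, the letter false
    divides by n. *)
Lemma nested_harmonic_le1 w n : nested_sum (@harmonic R) w n <= 1.
Proof.
elim/last_ind: w n => [|w l IH] n; first by rewrite lern1 leq_b1.
rewrite nested_rcons /nested_step /harmonic.
case: n => [|n]; first by rewrite invr0 mul0r.
rewrite mulrC ler_pdivrMr ?mul1r ?ltr0n //.
case: l.
  apply: (@le_trans _ _ (\sum_(i < n.+1) 1)); first by apply: ler_sum => i _.
  by rewrite sumr_const card_ord.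
by apply: (le_trans (IH _)); rewrite ler1n.
Qed.

(** The coefficients lie in [0, 1], so that a geometric series bounds the
    partial sums. *)
Lemma nneseries_Li (z : R) : 0 <= z < 1 ->
  (\sum_(n <oo) (nested_sum (@harmonic R) (word beta) n.+1 * z ^+ n.+1)%:E =
   (Li beta z)%:E)%E.
Proof.
move=> /andP[z0 z1]; set a := nested_sum _ _.
have a0 n : 0 <= a n by exact: nested_harmonic_ge0.
have a00 : a 0%N = 0.
  rewrite /a; case: (tval beta) (size_tuple beta) => [r0|b k' _].
    by move: (r_gt0); rewrite -r0.
  by rewrite nested_true0.
have LiE : Li beta z = limn (fun N => \sum_(n < N.+1) a n * z ^+ n).
  rewrite /Li; congr (limn _); apply/funext => N.
  rewrite -(sum_increasing (@harmonic R) (fun n => z ^+ n)) //.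
  apply: eq_bigr => n _; rewrite mulrC; congr (_ * _).
  by rewrite -prodfV; apply: eq_bigr => j _; rewrite exprVn.
have -> : (\sum_(n <oo) (a n.+1 * z ^+ n.+1)%:E =
    \sum_(n <oo) (a n * z ^+ n)%:E)%E.
  rewrite [RHS]nneseries_behead ?a00 ?mul0r // => n.
  by rewrite lee_fin mulr_ge0 // exprn_ge0.
have cv : cvgn (fun N => \sum_(n < N) a n * z ^+ n).
  apply: nondecreasing_is_cvgn.
    apply/nondecreasing_seqP => N; rewrite big_ord_recr /= lerDl.
    by rewrite mulr_ge0 // exprn_ge0.
  exists (1 - z)^-1 => _ [N _ <-].
  rewrite -[leRHS]mul1r -lee_fin -(@nneseries_geometric _ 1 z) ?z0 //.
  apply: le_trans (nneseries_lim_ge N _); last first.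
    by move=> n _ _; rewrite lee_fin mul1r exprn_ge0.
  rewrite sumEFin lee_fin big_mkord; apply: ler_sum => n _.
  by rewrite ler_wpM2r ?exprn_ge0 // nested_harmonic_le1.
have /cvg_ex [l hl] := cv.
have -> : Li beta z = l.
  rewrite LiE; apply/cvg_lim => //.
  by have := hl; rewrite -(cvg_shiftS (fun N => \sum_(n < N) a n * z ^+ n)).
apply/cvg_lim => //; under eq_fun do rewrite sumEFin big_mkord.
by apply/cvg_EFin => //; near=> N.
Unshelve. all: end_near.
Qed.

Variables (x : R) (m : nat).
Hypothesis x1_gt0 : 0 < x + 1.
Notation mu := (@lebesgue_measure R).

(** The factor 1/(e^t - 1) turns (1 - e^(-t))^(n+1) into
    e^(-t) (1 - e^(-t))^n. *)
Lemma Z1_integrandE t : 0 < t ->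
  ((expR (- (x * t)) / (expR t - 1) * Li beta (1 - expR (- t))
       * t `^ (m.+1%:R - 1))%:E =
  \sum_(n <oo) (m`!%:R * nested_sum (@harmonic R) (word beta) n.+1
     * kernel_fun (1 + x) m n t)%:E)%E.
Proof.
move=> t0; have /andP[e0 e1] := expRN_itv t0.
have z01 : 0 <= 1 - expR (- t) < 1 by rewrite subr_ge0 ltW //= ltrBlDr ltrDl.
have -> : t `^ (m.+1%:R - 1) = t ^+ m.
  by rewrite -natr1 addrK powR_mulrn // ltW.
rewrite mulrAC EFinM -(nneseries_Li z01) -nneseriesZl; last first.
  move=> n _; rewrite lee_fin mulr_ge0 ?nested_harmonic_ge0 // exprn_ge0 //.
  by case/andP: z01.
apply: eq_eseriesr => n _; rewrite -EFinM; congr _%:E.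
rewrite /kernel_fun /damped mulrDl mul1r opprD expRD exprS.
have et : expR t != 0 by rewrite gt_eqF ?expR_gt0.
have et1 : expR t - 1 != 0 by rewrite subr_eq0 gt_eqF // -expR0 ltr_expR.
have f0 : m`!%:R != 0 :> R by rewrite pnatr_eq0 -lt0n fact_gt0.
rewrite [expR (- t)]expRN.
move: ((1 - _) ^+ n) => Z; field.
by rewrite et et1 f0.
Qed.

Lemma integral_Z1 :
  (\int[mu]_(t in `]0%R, +oo[)
    (expR (- (x * t)) / (expR t - 1) * Li beta (1 - expR (- t))
       * t `^ (m.+1%:R - 1))%:E =
   m`!%:R%:E * \sum_(n <oo)
     (nested_sum (@harmonic R) (word beta) n.+1
      * (kernel m (1 + x) n)`_m)%:E)%E.
Proof.
have x1 : 0 < 1 + x by rewrite addrC.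
rewrite (_ : (\int[mu]_(t in _) _)%E = (\int[mu]_(t in `]0%R, +oo[)
   \sum_(n <oo) (m`!%:R * nested_sum (@harmonic R) (word beta) n.+1
      * kernel_fun (1 + x) m n t)%:E)%E); last first.
  apply: eq_integral => t; rewrite inE /= in_itv /= andbT => t0.
  exact: Z1_integrandE.
have c0 n : 0 <= m`!%:R * nested_sum (@harmonic R) (word beta) n.+1.
  by rewrite mulr_ge0 ?nested_harmonic_ge0.
rewrite integral_nneseries //=; last 2 first.
- move=> n; apply/measurable_EFinP/measurable_funM => //.
  exact: measurable_kernel_fun.
- move=> n t; rewrite in_itv /= andbT => /ltW t0.
  by rewrite lee_fin mulr_ge0 // kernel_fun_ge0.
rewrite -nneseriesZl; last first.
  by move=> n _; rewrite lee_fin mulr_ge0 ?nested_harmonic_ge0 // kernel_ge0.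
apply: eq_eseriesr => n _.
under eq_integral do rewrite EFinM.
rewrite ge0_integralZl_EFin //=.
- by rewrite (@integral_kernel_fun _ m) // -!EFinM mulrA.
- move=> t; rewrite in_itv /= andbT => /ltW t0.
  by rewrite lee_fin kernel_fun_ge0.
- by apply/measurable_EFinP; exact: measurable_kernel_fun.
Qed.

End Polylogarithm.

Lemma Gamma_natural (R : realType) m : Gamma m.+1%:R = m`!%:R :> R.
Proof.
rewrite /Gamma /Rintegral.
rewrite (_ : (\int[lebesgue_measure]_(t in _) _)%E =
   (\int[lebesgue_measure]_(t in `]0%R, +oo[)
      (m`!%:R%:E * (damped 1 m t)%:E))%E); last first.
  apply: eq_integral => t; rewrite inE /= in_itv /= andbT => t0.
  rewrite -natr1 addrK powR_mulrn ?ltW // -EFinM /damped mul1r; congr _%:E.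
  by field; rewrite pnatr_eq0 -lt0n fact_gt0.
rewrite ge0_integralZl_EFin //=.
- by rewrite integral_damped // invr1 expr1n mule1.
- move=> t; rewrite in_itv /= andbT => /ltW t0.
  by rewrite lee_fin damped_ge0.
- by apply/measurable_EFinP; exact: measurable_damped.
Qed.

(** * The theorem *)

Theorem theorem2 (R : realType) (q r : nat) (q_gt0 : (0 < q)%N)
  (r_gt0 : (0 < r)%N) (alpha : q.-tuple nat) (beta : r.-tuple nat)
  (alpha_gt0 : forall j : 'I_q, (0 < tnth alpha j)%N)
  (weight_alpha : (\sum_(j < q) tnth alpha j + 1 = q + r)%N)
  (dual_alpha_beta : dual_index (incr_last alpha) (incr_last beta))
  (m : nat) (x : R) (hx : 0 < x + 1) :
  Z1 beta m.+1%:R x =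
  \sum_(d : q.+1.-tuple 'I_m.+1 | (\sum_(i < q.+1) tnth d i)%N == m)
    (Mcoef alpha d)%:R * mzeta (shifted_index alpha d) x.
Proof.
have tuple_neq0 p (s : p.-tuple nat) : (0 < p)%N -> tval s != [::].
  by rewrite -size_eq0 size_tuple lt0n.
have alpha0 := tuple_neq0 _ alpha q_gt0.
have beta0 := tuple_neq0 _ beta r_gt0.
have alpha1 : all (leq 1) alpha by apply/all_tnthP.
have beta1 := dual_index_gt0 beta0 dual_alpha_beta.
have beta_gt0 : forall j, (0 < tnth beta j)%N by apply/all_tnthP.
rewrite /Z1 /Rintegral integral_Z1 // (nested_duality m hx alpha0 alpha1) //.
rewrite nneseries_nested_weight // -EFinM /= Gamma_natural mulKf //.
Qed.
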